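(* Let $\varepsilon>0$. For every sufficiently large $n$ there is a standard set $A\subset\mathbb Z_2^n$ such that \[ \lambda(A)<\varepsilon\quad\text{and}\quad \lambda^\pm(A)>\tfrac12-\varepsilon. \]
   Context: For a finite commutative group $G$ (written additively), a set $A\subset G$ is a standard set if $A=-A$ and $0\in A$. A character of $G$ is a homomorphism $\gamma:G\to\{z\in\mathbb C:|z|=1\}$; $\hat G$ is the group of characters and $\mathbf 1$ the principal character. For $f:G\to\mathbb R$, $\hat f(\gamma)=\sum_{x\in G}\gamma(x)f(x)$. For a standard set $A$, let $\mathcal S(A)$ be the set of functions $f:G\to\mathbb R$, not identically zero, with $f=0$ on $G\setminus A$, and $\mathcal S^\pm(A)$ the set of functions $f:G\to\mathbb R$, not identically zero, with $f\le 0$ on $G\setminus A$ and $f\ge 0$ on $A$. Then $\lambda(A)=\min\{f(0)/\hat f(\mathbf 1): f\in\mathcal S(A),\ \hat f(\gamma)\ge 0\ \forall\gamma\in\hat G\}$ and $\lambda^\pm(A)$ is defined the same way with $\mathcal S^\pm(A)$ in place of $\mathcal S(A)$. *)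

(* Defs.v *)
From HB Require Import structures.
From mathcomp Require Export all_boot all_order all_algebra.
From mathcomp Require Export complex.
From mathcomp Require Export boolp classical_sets reals.

Set Implicit Arguments.
Unset Strict Implicit.
Unset Printing Implicit Defensive.

Import Order.TTheory GRing.Theory Num.Theory.

Local Open Scope ring_scope.
Local Open Scope complex_scope.

Section Turan.
Variables (R : realType) (G : finZmodType).
Implicit Types (A : {set G}) (f : G -> R) (gamma : G -> R[i]).

Definition standard A : Prop :=
  A = [set - x | x in A]%SET /\ 0 \in A.

Definition character gamma : Prop :=
  (forall x y, gamma (x + y) = gamma x * gamma y) /\
  (forall x, `|gamma x| = 1).

Definition principal : G -> R[i] := fun=> 1.

Definition fourier f gamma : R[i] := \sum_(x : G) gamma x * (f x)%:C.

(* The order on R[i] is partial: 0 <= z means that z is real and nonnegative. *)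
Definition fourier_nonneg f : Prop :=
  forall gamma, character gamma -> 0 <= fourier f gamma.

Definition classS A f : Prop :=
  (exists x, f x != 0) /\ (forall x, x \notin A -> f x = 0).

Definition classSpm A f : Prop :=
  [/\ exists x, f x != 0,
      forall x, x \notin A -> f x <= 0 &
      forall x, x \in A -> 0 <= f x].

(* Division by zero yields 0 in the library, so the functions whose transform
   vanishes at the principal character (where the quotient is +oo, as f 0 > 0
   for every admissible f) have to be excluded explicitly. *)
Definition ratios (S : (G -> R) -> Prop) : set R :=
  [set r | exists f, [/\ S f, fourier_nonneg f, fourier f principal != 0 &
                         r%:C = (f 0)%:C / fourier f principal]]%classic.

Definition is_minimum (E : set R) (m : R) : Prop :=
  E m /\ (forall r, E r -> m <= r).

(* Relational, so that asserting [is_lambda A l] includes the existence of the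
   minimum; l is then unique. *)
Definition is_lambda A (l : R) : Prop := is_minimum (ratios (classS A)) l.

Definition is_lambda_pm A (l : R) : Prop := is_minimum (ratios (classSpm A)) l.

End Turan.

(* Main.v *)
(* Write |x| for the Hamming weight on the cube and take A to be 0 together with
   the vectors of weight at least n - d, where d is a small fraction of n. The
   Walsh transform turns multiplication by n - 2|x| into the sum of the
   translates by the unit vectors e_i.

   This identity at 0 shows that a positive definite f satisfies
   2 sum_x |x| f(x) <= n sum_x f(x). If f is in S^pm(A), then (n - d - |x|) f(x)
   is nonpositive for x <> 0, so sum_x (n - d - |x|) f(x) <= n f(0). The two
   inequalities give lambda^pm(A) >= 1/2 - d/n.

   The identity also shows, by induction on the degree, that the transform of
   y |-> q(|y|) vanishes at vectors of weight exceeding deg q. Hence, if q has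
   degree at most d, the function with transform 1 + chi_y(1,...,1) q(|y|)
   equals [x = 0] off the vectors of weight at least n - d. Rescale the
   Chebyshev polynomial T_d to obtain q bounded by 1 at 1, ..., n with
   q(0) = T_d(1 + 2/n) >= 1 + 2 d^2 / n. Then that function shows that
   lambda(A) <= 1 / (1 + q(0)), which tends to 0.

   The minima exist by compactness: Fourier inversion gives |f| <= f(0) for
   every positive definite f, so those normalised by f(0) = 1 lie in a compact
   box. *)

Require Import Defs.
From mathcomp Require Import all_boot all_order all_algebra.
From mathcomp Require Import reals.
From mathcomp Require Import topology normedtype derive trigo ring lra zify.

Set Implicit Arguments.
Unset Strict Implicit.
Unset Printing Implicit Defensive.

Import Order.TTheory GRing.Theory Num.Theory.
Import numFieldNormedType.Exports ArrowAsProduct.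

Local Open Scope ring_scope.

Fixpoint chebyshevT (R : nzRingType) (k : nat) : {poly R} :=
  match k with
  | 0 => 1
  | 1 => 'X
  | (k'.+1 as k1).+1 => 2 *: ('X * chebyshevT R k1) - chebyshevT R k'
  end.

Lemma chebyshevTSS (R : nzRingType) k :
  chebyshevT R k.+2 = 2 *: ('X * chebyshevT R k.+1) - chebyshevT R k.
Proof. by []. Qed.

Lemma size_chebyshevT (R : nzRingType) k : (size (chebyshevT R k) <= k.+1)%N.
Proof.
elim/ltn_ind: k => -[|[|k]] IHk; rewrite ?size_poly1 ?size_polyX //.
rewrite chebyshevTSS (leq_trans (size_polyD _ _)) // size_polyN geq_max.
apply/andP; split; last exact/leqW/leqW/IHk/leqW.
rewrite (leq_trans (size_scale_leq _ _)) // (leq_trans (size_polyMleq _ _)) //.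
by rewrite size_polyX; exact: IHk.
Qed.

Lemma horner_chebyshevTSS (R : comNzRingType) k (z : R) :
  (chebyshevT R k.+2).[z] =
  2 * z * (chebyshevT R k.+1).[z] - (chebyshevT R k).[z].
Proof. by rewrite chebyshevTSS !hornerE. Qed.

Lemma chebyshevT_cos (R : realType) k (theta : R) :
  (chebyshevT R k).[cos theta] = cos (k%:R * theta).
Proof.
elim/ltn_ind: k => -[|[|k]] IHk; first by rewrite hornerC mul0r cos0.
  by rewrite hornerX mul1r.
rewrite horner_chebyshevTSS !IHk //.
have -> : k%:R * theta = k.+1%:R * theta - theta by rewrite -natr1; ring.
have -> : k.+2%:R * theta = k.+1%:R * theta + theta.
  by rewrite -[k.+2%:R]natr1; ring.
by rewrite cosB cosD; ring.
Qed.

Lemma normr_chebyshevT_le1 (R : realType) k (z : R) :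
  `|z| <= 1 -> `|(chebyshevT R k).[z]| <= 1.
Proof.
by rewrite ler_norml => z_itv; rewrite -(acosK z_itv) chebyshevT_cos cos_max.
Qed.

Lemma chebyshevT_ge (R : realFieldType) k (t : R) : 0 <= t ->
  1 + k%:R ^+ 2 * t <= (chebyshevT R k).[1 + t].
Proof.
move=> t_ge0; suff [] : 1 + k%:R ^+ 2 * t <= (chebyshevT R k).[1 + t] /\
    (2 * k%:R + 1) * t <=
    (chebyshevT R k.+1).[1 + t] - (chebyshevT R k).[1 + t] by [].
elim: k => [|k [IHk IHdiff]]; first by rewrite hornerX hornerC; lra.
have Tk1_ge : 1 + k.+1%:R ^+ 2 * t <= (chebyshevT R k.+1).[1 + t].
  by rewrite -natr1; lra.
have tTk1_ge0 : 0 <= t * ((chebyshevT R k.+1).[1 + t] - 1).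
  rewrite mulr_ge0 // subr_ge0 (le_trans _ Tk1_ge) // lerDl.
  by rewrite mulr_ge0 ?sqr_ge0.
by rewrite horner_chebyshevTSS -natr1; split => //; lra.
Qed.

Section ClosedCones.
Local Open Scope classical_set_scope.
Variables (R : realType) (I : finType).
Implicit Types f c : I -> R.

Lemma continuous_eval (i : I) : continuous (fun f : I -> R => f i).
Proof. exact: (@proj_continuous I (fun=> R) i). Qed.

Lemma continuous_weighted_sum c : continuous (fun f => \sum_i c i * f i).
Proof.
apply: continuous_big => [|i _ f]; first exact: add_continuous.
exact: cvg_comp (@continuous_eval i f) (@mulrl_continuous R (c i) (f i)).
Qed.

Lemma closed_pointwise (K : I -> set R) :
  (forall i, closed (K i)) -> closed [set f | forall i, K i (f i)].
Proof.
move=> K_closed.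
rewrite (_ : [set f | _] = \bigcap_i [set f | K i (f i)]); last first.
  by apply/seteqP; split=> f Kf i; [move=> _|]; exact: Kf.
apply: closed_bigI => i _.
exact: preimage_closed (fun f _ => @continuous_eval i f) (K_closed i).
Qed.

Section NormalizedCone.
Variables (C : set (I -> R)) (i0 : I).
Hypotheses (C_closed : closed C)
  (C_scale : forall a f, 0 <= a -> C f -> C (fun i => a * f i))
  (C_bound : forall f i, C f -> `|f i| <= f i0).

Definition cone_slice : set (I -> R) := C `&` [set f | f i0 = 1].

Lemma compact_cone_slice : compact cone_slice.
Proof.
apply: (@subclosed_compact _ cone_slice [set f | forall i, `[-1, 1] (f i)]).
- apply: closedI => //.
  exact: preimage_closed (fun f _ => @continuous_eval i0 f) (@closed_eq R 1).
- apply: (@tychonoff I (fun=> R : topologicalType) (fun=> `[-1, 1])) => i.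
  exact: segment_compact.
- by move=> f [Cf fi0] i; rewrite /= in_itv /= -ler_norml -fi0 C_bound.
Qed.

Lemma cone_slice_normalize f :
  C f -> 0 < f i0 -> cone_slice (fun i => (f i0)^-1 * f i).
Proof.
move=> Cf fi0_gt0; split; first by apply: C_scale; rewrite ?invr_ge0 ?ltW.
by rewrite /= mulVf ?gt_eqF.
Qed.

Lemma cone_apex_gt0 c f : C f -> 0 < \sum_i c i * f i -> 0 < f i0.
Proof.
move=> Cf; rewrite [0 < f i0]lt_def (le_trans _ (C_bound i0 Cf)) // andbT.
apply: contraTneq => fi0_eq0; rewrite big1 ?ltxx // => i _.
have := C_bound i Cf; rewrite fi0_eq0 normr_le0 => /eqP->.
by rewrite mulr0.
Qed.

Lemma cone_ratio_minimum c : (exists2 f, C f & 0 < \sum_i c i * f i) ->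
  exists l, is_minimum [set f i0 / \sum_i c i * f i |
    f in [set f | C f /\ 0 < \sum_i c i * f i]] l.
Proof.
move=> [f1 Cf1 sum1_gt0].
have f1i0_gt0 := cone_apex_gt0 Cf1 sum1_gt0.
have [g /set_mem[Cg gi0] g_max] := compact_EVT_max
  (ex_intro _ _ (cone_slice_normalize Cf1 f1i0_gt0)) compact_cone_slice
  (continuous_subspaceT (@continuous_weighted_sum c)).
have sum_le f : C f -> 0 < f i0 ->
    (f i0)^-1 * \sum_i c i * f i <= \sum_i c i * g i.
  move=> Cf fi0_gt0; rewrite mulr_sumr; under eq_bigr do rewrite mulrCA.
  exact/g_max/mem_set/cone_slice_normalize.
have sum_gt0 : 0 < \sum_i c i * g i.
  by apply: lt_le_trans (sum_le f1 Cf1 f1i0_gt0); rewrite mulr_gt0 ?invr_gt0.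
exists (\sum_i c i * g i)^-1; split=> [|_ [f [Cf sumf_gt0] <-]].
  by exists g; rewrite //= gi0 mul1r.
have fi0_gt0 := cone_apex_gt0 Cf sumf_gt0.
rewrite -[leRHS]invf_div lef_pV2 ?posrE ?divr_gt0 //.
by rewrite mulrC; exact: sum_le.
Qed.

End NormalizedCone.

End ClosedCones.

Section HammingWeight.
Variables (V : zmodType) (n : nat).
Implicit Types x y : 'rV[V]_n.

Definition hamming_weight x : nat := #|[set i | x 0 i != 0]|.

Lemma hamming_weight_eq0 x : (hamming_weight x == 0%N) = (x == 0).
Proof.
rewrite cards_eq0; apply/eqP/eqP => [/setP x0|->].
  by apply/rowP => i; have := x0 i; rewrite !inE => /negbFE/eqP->; rewrite mxE.
by apply/setP => i; rewrite !inE mxE eqxx.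
Qed.

Lemma hamming_weight0 : hamming_weight (0 : 'rV[V]_n) = 0%N.
Proof. by apply/eqP; rewrite hamming_weight_eq0. Qed.

Lemma max_hamming_weight x : (hamming_weight x <= n)%N.
Proof. by rewrite -[leqRHS]card_ord max_card. Qed.

Lemma leq_hamming_weight_shift x y :
  (hamming_weight x <= hamming_weight (x + y) + hamming_weight y)%N.
Proof.
apply: leq_trans (leq_card_setU _ _); apply/subset_leq_card/subsetP => i.
rewrite !inE mxE -negb_and; apply: contraNN => /andP[/[swap] /eqP->].
by rewrite addr0.
Qed.

End HammingWeight.

Lemma hamming_weight_delta (V : nzRingType) n (i : 'I_n) :
  hamming_weight (delta_mx 0 i : 'rV[V]_n) = 1%N.
Proof.
rewrite -[RHS](cards1 i); congr #|pred_of_set _|; apply/setP => j.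
by rewrite !inE mxE eqxx /=; case: (j == i); rewrite ?eqxx ?oner_eq0.
Qed.

Lemma hamming_weight_const1 (V : nzRingType) n :
  hamming_weight (const_mx 1 : 'rV[V]_n) = n.
Proof.
rewrite -[RHS]card_ord -cardsT; congr #|pred_of_set _|; apply/setP => j.
by rewrite !inE mxE oner_eq0.
Qed.

Lemma sum_nontrivial_character_eq0 (G : finZmodType) (R : idomainType)
    (g : G -> R) (x0 : G) :
  {morph g : x y / x + y >-> x * y} -> g x0 != 1 -> \sum_x g x = 0.
Proof.
move=> gD gx0; apply/eqP; have : (g x0 - 1) * \sum_x g x == 0.
  rewrite mulrBl mul1r subr_eq0 mulr_sumr [eqbRHS](reindex_inj (addrI x0)) /=.
  by apply/eqP/eq_bigr => x _; rewrite gD.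
by rewrite mulf_eq0 subr_eq0 (negPf gx0).
Qed.

Section WalshTransform.
Variables (R : numDomainType) (n : nat).
Local Notation cube := 'rV['Z_2]_n.
Implicit Types (f : cube -> R) (x y z : cube) (i : 'I_n).

Definition sign2 (a : 'Z_2) : R := (-1) ^+ a.

Lemma sign2D a b : sign2 (a + b) = sign2 a * sign2 b.
Proof. by rewrite -exprD -[RHS]signr_odd -modn2. Qed.

Lemma sign2E a : sign2 a = 1 - 2 * (a != 0)%:R.
Proof. by case: a => -[|[|//]] ?; rewrite /sign2 /=; ring. Qed.

Lemma sum_sign2 x : \sum_i sign2 (x 0 i) = n%:R - 2 * (hamming_weight x)%:R.
Proof.
rewrite /hamming_weight -sum1dep_card natr_sum [in RHS]big_mkcond.
rewrite (eq_bigr _ (fun i _ => sign2E (x 0 i))) sumrB sumr_const card_ord.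
by rewrite mulr_sumr; congr (_ - _); apply: eq_bigr => i _; case: ifP.
Qed.

Lemma cube_addxx x : x + x = 0.
Proof.
apply/rowP => i; rewrite !mxE.
by case: (x 0 i) => -[|[|//]] ?; apply/val_inj.
Qed.

Lemma cube_oppr x : - x = x.
Proof. by apply/eqP; rewrite eq_sym -addr_eq0 cube_addxx. Qed.

Lemma card_cube_gt0 : 0 < #|{: cube}|%:R :> R.
Proof. by rewrite ltr0n; apply/card_gt0P; exists 0. Qed.

Definition chi y x : R := sign2 ((x *m y^T) 0 0).

Lemma chiC y x : chi y x = chi x y.
Proof. by rewrite /chi -[in LHS](trmxK x) -trmx_mul mxE. Qed.

Lemma chiD y : {morph chi y : x z / x + z >-> x * z}.
Proof. by move=> x z; rewrite /chi mulmxDl mxE sign2D. Qed.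

Lemma chi0 y : chi y 0 = 1.
Proof. by rewrite /chi mul0mx mxE. Qed.

Lemma chi_delta y i : chi y (delta_mx 0 i) = sign2 (y 0 i).
Proof. by rewrite /chi -rowE !mxE. Qed.

Lemma normr_chi y x : `|chi y x| = 1.
Proof. by rewrite normrX normrN1 expr1n. Qed.

Definition walsh f y : R := \sum_x chi y x * f x.

Lemma walsh0 f : walsh f 0 = \sum_x f x.
Proof. by apply: eq_bigr => x _; rewrite chiC chi0 mul1r. Qed.

Lemma walsh_delta0 y : walsh (fun x => (x == 0)%:R) y = 1.
Proof.
rewrite /walsh (bigD1 0) //= chi0 eqxx mulr1 big1 ?addr0 // => x /negPf->.
by rewrite mulr0.
Qed.

Lemma walshZ a f y : walsh (fun x => a * f x) y = a * walsh f y.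
Proof. by rewrite /walsh mulr_sumr; apply: eq_bigr => x _; rewrite mulrCA. Qed.

Lemma walshD f g y : walsh (fun x => f x + g x) y = walsh f y + walsh g y.
Proof. by rewrite /walsh -big_split; apply: eq_bigr => x _; rewrite mulrDr. Qed.

Lemma walsh_chi f z y : walsh (fun x => chi z x * f x) y = walsh f (y + z).
Proof.
by apply: eq_bigr => x _; rewrite mulrA ![chi _ x]chiC chiD.
Qed.

Lemma walsh1 y : walsh (fun=> 1) y = #|{: cube}|%:R * (y == 0)%:R.
Proof.
have [->|y_neq0] := eqVneq y 0; first by rewrite walsh0 sumr_const mulr1.
rewrite mulr0 /walsh; under eq_bigr do rewrite mulr1.
have [i yi_neq0] : exists i, y 0 i != 0.
  apply/existsP; apply: contraNT y_neq0 => /existsPn y_eq0.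
  by apply/eqP/rowP => i; rewrite mxE; exact/eqP/negPn/y_eq0.
apply: (sum_nontrivial_character_eq0 (x0 := delta_mx 0 i)); first exact: chiD.
rewrite chi_delta sign2E yi_neq0 mulr1 -subr_eq0 addrAC subrr sub0r oppr_eq0.
by rewrite pnatr_eq0.
Qed.

Lemma walshK f x : walsh (walsh f) x = #|{: cube}|%:R * f x.
Proof.
transitivity (\sum_z f z * walsh (fun=> 1) (x + z)).
  rewrite /walsh; under eq_bigr do rewrite mulr_sumr.
  rewrite exchange_big /=; apply: eq_bigr => z _; rewrite mulr_sumr.
  by apply: eq_bigr => y _; rewrite mulr1 mulrA mulrC -!(chiC y) chiD.
rewrite (bigD1 x) //= walsh1 cube_addxx eqxx mulr1 mulrC big1 ?addr0 // => z zx.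
by rewrite walsh1 addr_eq0 cube_oppr eq_sym (negPf zx) !mulr0.
Qed.

Lemma walsh_weight f y :
  2 * walsh (fun x => (hamming_weight x)%:R * f x) y =
  n%:R * walsh f y - \sum_i walsh f (y + delta_mx 0 i).
Proof.
under eq_bigr do rewrite -walsh_chi.
rewrite exchange_big /= !mulr_sumr -sumrB; apply: eq_bigr => x _.
under eq_bigr do rewrite mulrCA chiC chi_delta.
by rewrite -mulr_suml sum_sign2; ring.
Qed.

Lemma walsh_weight_poly_eq0 (p : {poly R}) z : (size p <= hamming_weight z)%N ->
  walsh (fun y => p.[(hamming_weight y)%:R]) z = 0.
Proof.
elim/poly_ind: p z => [|p c IHp] z size_le.
  by apply: big1 => y _; rewrite horner0 mulr0.
have [pXc_eq0|pXc_neq0] := eqVneq (p * 'X + c%:P) 0.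
  by apply: big1 => y _; rewrite pXc_eq0 horner0 mulr0.
have {size_le} size_lt : (size p < hamming_weight z)%N.
  move: size_le; rewrite size_MXaddC ifF //; apply: contraNF pXc_neq0.
  by move=> /andP[/eqP-> /eqP->]; rewrite mul0r addr0.
pose F (y : cube) := p.[(hamming_weight y)%:R].
have -> : walsh (fun y => (p * 'X + c%:P).[(hamming_weight y)%:R]) z =
    walsh (fun y => (hamming_weight y)%:R * F y) z + c * walsh (fun=> 1) z.
  rewrite -walshZ -walshD; apply: eq_bigr => y _.
  by rewrite hornerMXaddC mulr1 [X in X + c]mulrC.
have z_neq0 : z != 0 by rewrite -hamming_weight_eq0 -lt0n (leq_trans _ size_lt).
rewrite walsh1 (negPf z_neq0) !mulr0 addr0.
have two_neq0 : 2 != 0 :> R by rewrite pnatr_eq0.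
apply: (mulfI two_neq0); rewrite mulr0 walsh_weight IHp ?(ltnW size_lt) //.
rewrite mulr0 sub0r big1 ?oppr0 // => i _.
apply: IHp; have := leq_hamming_weight_shift z (delta_mx 0 i).
by rewrite hamming_weight_delta addn1 => /(leq_trans size_lt).
Qed.

Definition positive_definite f := forall y, 0 <= walsh f y.

Lemma positive_definite_bound f x : positive_definite f -> `|f x| <= f 0.
Proof.
move=> f_pd; rewrite -(ler_pM2l card_cube_gt0).
rewrite -[X in X * _](gtr0_norm card_cube_gt0) -normrM -!walshK walsh0.
apply: le_trans (ler_norm_sum _ _ _) _; apply: ler_sum => y _.
by rewrite normrM normr_chi mul1r ger0_norm.
Qed.

Lemma positive_definite_mean_weight f : positive_definite f ->
  2 * \sum_x (hamming_weight x)%:R * f x <= n%:R * \sum_x f x.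
Proof. by move=> f_pd; rewrite -!walsh0 walsh_weight gerBl sumr_ge0. Qed.

End WalshTransform.

Section CubeFourier.
Variables (R : realType) (n : nat).
Local Notation cube := 'rV['Z_2]_n.
Implicit Types (f : cube -> R) (gamma : cube -> R[i]) (A : {set cube}).
Local Open Scope complex_scope.

Lemma character_chi (y : cube) : character (fun x => (chi R y x)%:C).
Proof.
split=> [x z|x]; first by rewrite chiD rmorphM.
by rewrite normc_def /= expr0n addr0 sqrtr_sqr normr_chi.
Qed.

Lemma characterP gamma :
  character gamma <-> exists y, gamma = (fun x => (chi R y x)%:C).
Proof.
split=> [[gammaD gamma_norm]|[y ->]]; last exact: character_chi.
have gamma0 : gamma 0 = 1.
  have gamma0_neq0 : gamma 0 != 0 by rewrite -normr_eq0 gamma_norm oner_eq0.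
  by apply: (mulfI gamma0_neq0); rewrite -gammaD addr0 mulr1.
have gamma_pm1 x : gamma x = 1 \/ gamma x = -1.
  have /eqP : gamma x ^+ 2 = 1 by rewrite expr2 -gammaD cube_addxx.
  by rewrite sqrf_eq1 => /orP[] /eqP; [left|right].
pose y : cube := \row_i (gamma (delta_mx 0 i) != 1)%:R.
have gamma_delta i : gamma (delta_mx 0 i) = (chi R y (delta_mx 0 i))%:C.
  rewrite chi_delta mxE; have [->|->] := gamma_pm1 (delta_mx 0 i).
    by rewrite eqxx.
  have -> : -1 != 1 :> R[i] by rewrite eq_sym -addr_eq0 (pnatr_eq0 _ 2).
  by rewrite /sign2 expr1 rmorphN1.
exists y; apply/funext => x; rewrite (row_sum_delta x).
rewrite (big_morph _ gammaD gamma0) (big_morph _ (@chiD R n y) (chi0 R y)).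
rewrite rmorph_prod; apply: eq_bigr => i _.
have [->|->] : x 0 i = 0 \/ x 0 i = 1.
- by case: (x 0 i) => -[|[|//]] ?; [left|right]; exact/val_inj.
- by rewrite scale0r gamma0 chi0.
- by rewrite scale1r.
Qed.

Lemma fourier_chi f y : fourier f (fun x => (chi R y x)%:C) = (walsh f y)%:C.
Proof.
by rewrite /walsh rmorph_sum; apply: eq_bigr => x _; rewrite rmorphM.
Qed.

Lemma fourier_principal f : fourier f (@principal R cube) = (walsh f 0)%:C.
Proof. by rewrite -fourier_chi; apply: eq_bigr => x _; rewrite chiC chi0. Qed.

Lemma fourier_nonnegP f : fourier_nonneg f <-> positive_definite f.
Proof.
split=> [f_ge0 y|f_pd gamma /characterP[y ->]].
  by rewrite -lecR -fourier_chi; exact/f_ge0/character_chi.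
by rewrite fourier_chi lecR.
Qed.

Lemma ratiosP (S : (cube -> R) -> Prop) r : ratios S r <->
  exists f, [/\ S f, positive_definite f, 0 < walsh f 0 & r = f 0 / walsh f 0].
Proof.
split=> -[f]; rewrite ?fourier_principal ?fmorph_eq0 => -[Sf].
  move=> /fourier_nonnegP f_pd walsh_neq0 /eqP; rewrite -fmorph_div => /eqP rE.
  by exists f; split; rewrite ?lt_def ?walsh_neq0 ?f_pd //; exact: complexI.
move=> f_pd walsh_gt0 ->; exists f; rewrite fourier_principal fmorph_eq0.
by split; rewrite ?gt_eqF ?fmorph_div //; exact/fourier_nonnegP.
Qed.

Lemma closed_positive_definite :
  closed (@positive_definite R n : set (cube -> R)).
Proof.
rewrite (_ : @positive_definite R n =
  \bigcap_y [set f | 0 <= walsh f y])%classic; last first.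
  by apply/seteqP; split=> f f_pd y; [move=> _|]; exact: f_pd.
apply: closed_bigI => y _.
exact: preimage_closed (fun f _ => @continuous_weighted_sum R cube (chi R y) f)
  (@closed_ge R 0).
Qed.

Lemma ratios_minimum (S : (cube -> R) -> Prop) (C : set (cube -> R)) :
  (forall f, S f <-> (exists x, f x != 0) /\ C f) ->
  closed C -> (forall a f, 0 <= a -> C f -> C (fun x => a * f x)) ->
  C (fun x => (x == 0)%:R) ->
  exists l, is_minimum (ratios S) l.
Proof.
move=> SE C_closed C_scale C_delta0.
pose P := (C `&` @positive_definite R n)%classic.
have P_closed : closed P by exact: closedI closed_positive_definite.
have P_scale a f : 0 <= a -> P f -> P (fun x => a * f x).
  move=> a_ge0 [Cf f_pd]; split; first exact: C_scale.
  by move=> y; rewrite walshZ mulr_ge0.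
have P_bound f x : P f -> `|f x| <= f 0.
  by case=> _; exact: positive_definite_bound.
have [|l] := cone_ratio_minimum (c := chi R 0) P_closed P_scale P_bound.
  exists (fun x => (x == 0)%:R); last by rewrite [ltRHS]walsh_delta0.
  by split=> // y; rewrite walsh_delta0.
rewrite (_ : (_ @` _)%classic = ratios S); first by exists l.
apply/seteqP; split=> r; last first.
  by move=> /ratiosP[f [/SE[_ Cf] f_pd walsh_gt0 ->]]; exists f.
move=> [f [[Cf f_pd] walsh_gt0] <-]; apply/ratiosP; exists f; split => //.
apply/SE; split=> //; apply/existsP; apply: contraTT walsh_gt0 => /existsPn f0.
by rewrite big1 ?ltxx // => x _; have /negPn/eqP-> := f0 x; rewrite mulr0.
Qed.

Lemma is_lambda_exists A : 0 \in A -> exists l : R, is_lambda A l.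
Proof.
move=> A0.
pose K x := (if x \in A then [set: R] else [set 0])%classic.
apply: (ratios_minimum (C := [set f | forall x, K x (f x)]%classic));
  rewrite /K.
- move=> f; split=> -[f_neq0 fA]; split=> // x; first by case: ifPn => // /fA.
  by move=> /negPf xA; have := fA x; rewrite xA.
- apply: (@closed_pointwise _ _ K) => x; rewrite /K.
  by case: ifP => _; [exact: closedT | exact: closed_eq].
- by move=> a f _ fA x; have := fA x; case: ifP => // _ ->; exact: mulr0.
- move=> x; case: ifPn => //; apply: contraNeq.
  by rewrite pnatr_eq0 eqb0 negbK => /eqP->.
Qed.

Lemma is_lambda_pm_exists A : 0 \in A -> exists l : R, is_lambda_pm A l.
Proof.
move=> A0.
pose K x :=
  (if x \in A then [set t : R | 0 <= t] else [set t | t <= 0])%classic.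
apply: (ratios_minimum (C := [set f | forall x, K x (f x)]%classic));
  rewrite /K.
- move=> f; split=> [[f_neq0 f_le0 f_ge0]|[f_neq0 fA]]; split=> // x.
  + by case: ifPn; [exact: f_ge0 | exact: f_le0].
  + by move=> /negPf xA; have := fA x; rewrite xA.
  + by move=> xA; have := fA x; rewrite xA.
- apply: (@closed_pointwise _ _ K) => x; rewrite /K.
  by case: ifP => _; [exact: closed_ge | exact: closed_le].
- move=> a f a_ge0 fA x; have := fA x.
  by case: ifP => _; [exact: mulr_ge0 | exact: mulr_ge0_le0].
- move=> x; case: ifPn => [_|xA]; first exact: ler0n.
  by rewrite (_ : x == 0 = false) //=; apply: contraNF xA => /eqP->.
Qed.

Lemma standard_cube A : 0 \in A -> standard A.
Proof.
move=> A0; split=> //; rewrite -[LHS]imset_id.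
by apply: eq_imset => x; rewrite cube_oppr.
Qed.

End CubeFourier.

Section AntipodalSet.
Variables (R : realType) (n d : nat).
Local Notation cube := 'rV['Z_2]_n.
Implicit Types (f : cube -> R) (x y : cube) (q : {poly R}) (l : R).

Definition antipodal_set : {set cube} :=
  [set x | (x == 0) || (n <= hamming_weight x + d)%N].

Lemma mem0_antipodal_set : 0 \in antipodal_set.
Proof. by rewrite inE eqxx. Qed.

Definition turan_witness q x : R := #|{: cube}|%:R^-1 *
  walsh (fun y => 1 + chi R (const_mx 1) y * q.[(hamming_weight y)%:R]) x.

Lemma walsh_turan_witness q y : walsh (turan_witness q) y =
  1 + chi R (const_mx 1) y * q.[(hamming_weight y)%:R].
Proof. by rewrite walshZ walshK mulKf // gt_eqF ?card_cube_gt0. Qed.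

Lemma turan_witness_low_weight q x :
  (size q <= d.+1)%N -> (hamming_weight x + d < n)%N ->
  turan_witness q x = (x == 0)%:R.
Proof.
move=> size_q x_low; have card_neq0 := lt0r_neq0 (card_cube_gt0 R n).
apply: (mulfI card_neq0); rewrite mulVKf // -walsh1 walshD -[RHS]addr0.
rewrite walsh_chi walsh_weight_poly_eq0 // (leq_trans size_q) //.
rewrite -(ltn_add2l (hamming_weight x)) (leq_trans x_low) // addnC addrC.
have := leq_hamming_weight_shift (const_mx 1) x.
by rewrite hamming_weight_const1.
Qed.

Lemma is_lambda_antipodal_le_poly q l :
  (d < n)%N -> (size q <= d.+1)%N -> 0 <= q.[0] ->
  (forall k, (0 < k <= n)%N -> `|q.[k%:R]| <= 1) ->
  is_lambda antipodal_set l -> l <= (1 + q.[0])^-1.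
Proof.
move=> d_lt_n size_q q0_ge0 q_le1 [_ l_min].
have w0 : turan_witness q 0 = 1.
  by rewrite turan_witness_low_weight ?eqxx ?hamming_weight0.
have walsh_w0 : walsh (turan_witness q) 0 = 1 + q.[0].
  by rewrite walsh_turan_witness chi0 hamming_weight0 mul1r.
apply: l_min; apply/ratiosP; exists (turan_witness q); split.
- split; first by exists 0; rewrite w0 oner_neq0.
  move=> x; rewrite inE negb_or -ltnNge => /andP[/negPf x_neq0 x_low].
  by rewrite turan_witness_low_weight // x_neq0.
- move=> y; have [->|y_neq0] := eqVneq y 0; first by rewrite walsh_w0 addr_ge0.
  have : `|chi R (const_mx 1) y * q.[(hamming_weight y)%:R]| <= 1.
    rewrite normrM normr_chi mul1r q_le1 // max_hamming_weight andbT.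
    by rewrite lt0n hamming_weight_eq0.
  by rewrite ler_norml walsh_turan_witness -lerBlDl sub0r => /andP[].
- by rewrite walsh_w0 ltr_pwDl.
- by rewrite w0 walsh_w0 mul1r.
Qed.

(* The substitution maps [1, n] into [-1, 1] and 0 to 1 + 2 / n. *)
Definition scaled_chebyshevT : {poly R} :=
  chebyshevT R d \Po ((- (2 / n%:R))%:P * 'X + (1 + 2 / n%:R)%:P).

Lemma horner_scaled_chebyshevT (t : R) :
  scaled_chebyshevT.[t] = (chebyshevT R d).[1 + 2 / n%:R * (1 - t)].
Proof.
rewrite horner_comp hornerD hornerM !hornerC hornerX.
by congr _.[_]; ring.
Qed.

Lemma size_scaled_chebyshevT :
  (0 < n)%N -> (size scaled_chebyshevT <= d.+1)%N.
Proof.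
move=> n_gt0; rewrite size_comp_poly2 ?size_chebyshevT //.
have slope_neq0 : - (2 / n%:R) != 0 :> R.
  by rewrite oppr_eq0 mulf_neq0 ?invr_eq0 ?pnatr_eq0 -?lt0n.
by rewrite size_MXaddC polyC_eq0 size_polyC slope_neq0 (negPf slope_neq0).
Qed.

Lemma normr_scaled_chebyshevT_le1 k :
  (0 < k <= n)%N -> `|scaled_chebyshevT.[k%:R]| <= 1.
Proof.
move=> /andP[k_gt0 k_le_n].
rewrite horner_scaled_chebyshevT normr_chebyshevT_le1 //.
have n_gt0 : 0 < n%:R :> R by rewrite ltr0n (leq_trans k_gt0).
rewrite -(ler1n R) in k_gt0; rewrite -(ler_nat R) in k_le_n.
rewrite mulrAC ler_norml -lerBlDl gerDl ler_pdivlMr // ler_pdivrMr //.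
by apply/andP; split; lra.
Qed.

Lemma scaled_chebyshevT_at0_ge :
  1 + d%:R ^+ 2 * (2 / n%:R) <= scaled_chebyshevT.[0].
Proof.
by rewrite horner_scaled_chebyshevT subr0 mulr1 chebyshevT_ge ?divr_ge0.
Qed.

Lemma is_lambda_antipodal_le l : (d < n)%N -> is_lambda antipodal_set l ->
  l <= (2 + d%:R ^+ 2 * (2 / n%:R))^-1.
Proof.
move=> d_lt_n l_lambda; have n_gt0 : (0 < n)%N by exact: leq_trans d_lt_n.
have q0_ge := scaled_chebyshevT_at0_ge.
have step_ge0 : 0 <= d%:R ^+ 2 * (2 / n%:R) :> R.
  by rewrite mulr_ge0 ?sqr_ge0 ?divr_ge0.
apply: le_trans (is_lambda_antipodal_le_poly d_lt_n
  (size_scaled_chebyshevT n_gt0) _ normr_scaled_chebyshevT_le1 l_lambda) _.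
  by lra.
by rewrite lef_pV2 ?posrE; lra.
Qed.

Lemma classSpm_antipodal_sum_le f :
  classSpm antipodal_set f ->
  \sum_x (n%:R - d%:R - (hamming_weight x)%:R) * f x <= n%:R * f 0.
Proof.
move=> [_ f_le0 f_ge0]; have f0_ge0 := f_ge0 0 mem0_antipodal_set.
rewrite (bigD1 0) //= hamming_weight0 subr0 -[leRHS]addr0 lerD //.
  by rewrite ler_wpM2r // gerBl.
apply: sumr_le0 => x /negPf x_neq0; rewrite -addrA -opprD -natrD addnC.
have [xA|xA] := boolP (x \in antipodal_set).
  rewrite mulr_le0_ge0 ?f_ge0 //; move: xA; rewrite inE x_neq0 /=.
  by rewrite -(ler_nat R) subr_le0.
rewrite mulr_ge0_le0 ?f_le0 //; move: xA; rewrite inE x_neq0 /= -ltnNge.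
by move=> /ltnW; rewrite -(ler_nat R) subr_ge0.
Qed.

Lemma is_lambda_pm_antipodal_ge l : (0 < n)%N ->
  is_lambda_pm antipodal_set l -> 2^-1 - d%:R / n%:R <= l.
Proof.
move=> n_gt0 [/ratiosP[f [f_class f_pd walsh_gt0 ->]] _].
have := classSpm_antipodal_sum_le f_class.
under eq_bigr do rewrite mulrBl.
rewrite sumrB -mulr_sumr; have := positive_definite_mean_weight f_pd.
rewrite -[\sum_x f x]walsh0 => mean_weight weight_gap.
rewrite -(ltr0n R) in n_gt0.
rewrite (_ : 2^-1 - _ = (n%:R - 2 * d%:R) / (2 * n%:R)); last first.
  by field; rewrite gt_eqF.
by rewrite ler_pdivrMr ?mulr_gt0 // mulrAC ler_pdivlMr //; lra.
Qed.

End AntipodalSet.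

Lemma exists_intermediate_degree m n : (1 < m)%N -> (2 * m ^ 3 <= n)%N ->
  exists d, [/\ (d < n)%N, (d * m <= n)%N & (n * m <= d ^ 2)%N].
Proof.
move=> m_gt1 n_ge; have m_gt0 : (0 < m)%N by exact: ltnW.
have dm_le_n : (n %/ m * m <= n)%N by exact: leq_divM.
have n_lt : (n < (n %/ m).+1 * m)%N by exact: ltn_ceil.
have d_ge : (2 * m ^ 2 <= n %/ m)%N by rewrite leq_divRL // -mulnA -expnSr.
exists (n %/ m)%N; split=> //.
  by rewrite ltn_Pdiv // (leq_trans _ n_ge) // muln_gt0 expn_gt0 m_gt0.
move: (n %/ m)%N n_lt d_ge => d n_lt d_ge.
have n_le : (n <= 2 * d * m)%N by nia.
rewrite (leq_trans (leq_mul n_le (leqnn m))) // -mulnA mulnn mulnAC.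
by rewrite -mulnn leq_mul2r d_ge orbT.
Qed.

Theorem theorem1p6 (R : realType) (eps : R) (eps_gt0 : 0 < eps) :
  exists N : nat, forall n : nat, (N <= n)%N ->
  exists A : {set 'rV['Z_2]_n},
    standard A /\
    exists l lpm : R,
      [/\ is_lambda A l, is_lambda_pm A lpm, l < eps & lpm > 2^-1 - eps].
Proof.
have [k] := ltr_add_invr eps_gt0; rewrite add0r => k_inv.
pose m := k.+2; have m_inv : m%:R^-1 < eps.
  by apply: lt_trans k_inv; rewrite ltf_pV2 ?posrE ?ltr0n // ltr_nat.
exists (2 * m ^ 3)%N => n n_ge.
have [//|d [d_lt_n dm_le_n nm_le_d2]] := exists_intermediate_degree _ n_ge.
have n_gt0 : (0 < n)%N := leq_ltn_trans (leq0n d) d_lt_n.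
have A0 := mem0_antipodal_set n d.
have [l l_lambda] := is_lambda_exists R A0.
have [lpm lpm_lambda] := is_lambda_pm_exists R A0.
exists (antipodal_set n d); split; first exact: standard_cube.
exists l, lpm; split => //.
  apply: le_lt_trans (is_lambda_antipodal_le d_lt_n l_lambda) _.
  apply: lt_trans m_inv.
  have m_le : m%:R <= d%:R ^+ 2 / n%:R :> R.
    by rewrite ler_pdivlMr ?ltr0n // -natrM -natrX ler_nat mulnC.
  by rewrite ltf_pV2 ?posrE ?ltr0n //; have := ler0n R m; lra.
apply: lt_le_trans (is_lambda_pm_antipodal_ge n_gt0 lpm_lambda).
rewrite ltrD2l ltrN2 (le_lt_trans _ m_inv) //.
by rewrite ler_pdivrMr ?ltr0n // ler_pdivlMl ?ltr0n // -natrM ler_nat mulnC.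
Qed.
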